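(* Every locally contractive endofunctor $T:\mathcal N\to\mathcal N$ has a fixed point, i.e. there is an object $X$ of $\mathcal N$ and an isomorphism $\alpha:TX\to X$.
   Context: $\mathcal N=\mathbf{Coiso}^{\mathbb N^{\mathrm{op}}}$ ($\mathbf{Coiso}$: countably-dimensional Hilbert spaces and coisometries); objects are Hilbert spaces $X(n)$ with coisometries $r^X_n:X(n+1)\to X(n)$, morphisms natural transformations. $\mathcal S=\mathbf{Set}^{\mathbb N^{\mathrm{op}}}$; the later functor $L^{\mathcal S}$ sets $LX(0)$ a singleton, $LX(n+1)=X(n)$ (restrictions shifted), and $\nu:\mathrm{id}\Rightarrow L^{\mathcal S}$ has $\nu_{X,0}$ the unique map and $\nu_{X,n+1}=r^X_n$. $\mathcal N$ is $\mathcal S$-enriched: $\mathcal N(X,Y)(n)$ is the set of $n$-th components of morphisms $X\to Y$, restriction $h\mapsto r^Y_n\circ h\circ(r^X_n)^\dagger$, componentwise composition. An $\mathcal S$-enriched functor $T$ (action maps $T_{X,Y}:\mathcal N(X,Y)\to\mathcal N(TX,TY)$ in $\mathcal S$) is locally contractive if there are $G_{X,Y}:L^{\mathcal S}\mathcal N(X,Y)\to\mathcal N(TX,TY)$ in $\mathcal S$ with $T_{X,Y}=G_{X,Y}\circ\nu_{\mathcal N(X,Y)}$, compatible with composition and identities (i.e. $G_{X,Z}\circ L(\mathrm{comp})\circ\cong=\mathrm{comp}\circ(G_{Y,Z}\times G_{X,Y})$ and $G_{X,X}\circ L(\mathrm{id})=\mathrm{id}_{TX}$). *)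

(* Defs.v *)
From HB Require Import structures.
From mathcomp Require Import all_boot all_order all_algebra.
From mathcomp Require Import sesquilinear complex.
From mathcomp Require Import boolp classical_sets functions cardinality reals.
From mathcomp Require Import topology normedtype.

Set Implicit Arguments.
Unset Strict Implicit.
Unset Printing Implicit Defensive.

Import Order.TTheory GRing.Theory Num.Theory.
Import numFieldNormedType.Exports.

Local Open Scope classical_set_scope.
Local Open Scope ring_scope.
Local Open Scope complex_scope.

Section Basis.
Context {R : realType} {V : normedModType R[i]}.

Definition lspan (B : set V) : set V :=
  [set x | exists n (a : 'I_n -> R[i]) (b : 'I_n -> V),
     (forall i, B (b i)) /\ x = \sum_(i < n) a i *: b i].

Definition orthonormal_basis (dot : V -> V -> R[i]) (B : set V) : Prop :=
  [/\ forall b, B b -> dot b b = 1,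
      forall b c, B b -> B c -> b <> c -> dot b c = 0
    & dense (lspan B)].

End Basis.

(* [countable] allows finite sets, so finite-dimensional spaces, including 0,
   are objects. *)
Record hilbert (R : realType) := Hilbert {
  hcarrier :> completeNormedModType R[i];
  hdot : {dot hcarrier for Num.conj};
  hdotE : forall x : hcarrier, hdot x x = `|x| ^+ 2;
  hcountable_dim : exists B : set hcarrier,
    countable B /\ orthonormal_basis hdot B }.

(* The adjoint is unique, so it can be carried as data: see [coiso_ext]. *)
Record coiso (R : realType) (H K : hilbert R) := Coiso {
  coiso_fun :> H -> K;
  dag : K -> H;
  coiso_linear : linear coiso_fun;
  coiso_continuous : continuous coiso_fun;
  dagP : forall x y, hdot K (coiso_fun x) y = hdot H x (dag y);
  coisoK : forall y, coiso_fun (dag y) = y }.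

Section CoisoTheory.
Context {R : realType}.
Implicit Types H K M : hilbert R.

Lemma hdot_injr H (y z : H) : (forall x, hdot H x y = hdot H x z) -> y = z.
Proof.
move=> eq_yz; apply/eqP; rewrite -subr_eq0 -normr_eq0 -sqrf_eq0 -hdotE.
by rewrite linearBr/= eq_yz subrr.
Qed.

Lemma coiso_ext H K (f g : coiso H K) : f =1 g -> f = g.
Proof.
case: f g => [f f' fl fc fP fK] [g g' gl gc gP gK] /= /funext fg.
subst g; have fg' : f' = g'.
  by apply/funext => y; apply: hdot_injr => x; rewrite -fP -gP.
by subst g'; congr Coiso; exact: Prop_irrelevance.
Qed.

Lemma dag_linear H K (f : coiso H K) : linear (dag f).
Proof.
move=> a x y; apply: hdot_injr => z.
by rewrite -dagP !linearDr !linearZr_LR/= !dagP.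
Qed.

Lemma dag_norm H K (f : coiso H K) (y : K) : `|dag f y| = `|y|.
Proof.
apply/eqP; rewrite -(@eqrXn2 _ 2)// -!hdotE.
by rewrite -dagP coisoK.
Qed.

Lemma dag_continuous H K (f : coiso H K) : continuous (dag f).
Proof.
pose g : {linear K -> H} :=
  HB.pack (dag f) (GRing.isLinear.Build _ _ _ _ (dag f) (dag_linear f)).
apply: (@bounded_linear_continuous _ _ _ g); apply/linear_boundedP.
exists 1; split=> // r r1 x; rewrite dag_norm ler_peMl//.
exact: ltW.
Qed.

Definition coiso_id H : coiso H H.
Proof.
by exists id id => // x; exact: cvg_id.
Defined.

Definition coiso_comp H K M (g : coiso K M) (f : coiso H K) : coiso H M.
Proof.
exists (g \o f) (dag f \o dag g).
- by move=> a x y /=; rewrite !coiso_linear.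
- by move=> x; apply: continuous_comp; exact: coiso_continuous.
- by move=> x y /=; rewrite !dagP.
- by move=> y /=; rewrite !coisoK.
Defined.

End CoisoTheory.

(* [nobj] and [nmor] are Coiso^(nat^op). *)
Record nobj (R : realType) := NObj {
  nspace :> nat -> hilbert R;
  nres : forall n, coiso (nspace n.+1) (nspace n) }.

Record nmor (R : realType) (X Y : nobj R) := NMor {
  ncomponent :> forall n, coiso (X n) (Y n);
  nmor_natural : forall n (x : X n.+1),
    ncomponent n (nres X n x) = nres Y n (ncomponent n.+1 x) }.

Section NCategory.
Context {R : realType}.
Implicit Types X Y Z : nobj R.

Lemma nmor_ext X Y (f g : nmor X Y) : (forall n, f n =1 g n) -> f = g.
Proof.
case: f g => [f fN] [g gN] /= fg.
have {fg} fg : f = g by apply: functional_extensionality_dep => n; exact: coiso_ext.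
by subst g; congr NMor; exact: Prop_irrelevance.
Qed.

Definition nid X : nmor X X.
Proof. by exists (fun n => coiso_id (X n)). Defined.

Definition ncomp X Y Z (g : nmor Y Z) (f : nmor X Y) : nmor X Z.
Proof.
exists (fun n => coiso_comp (g n) (f n)).
by move=> n x /=; rewrite !nmor_natural.
Defined.

Definition is_niso X Y (f : nmor X Y) : Prop :=
  exists g : nmor Y X, ncomp g f = nid X /\ ncomp f g = nid Y.

End NCategory.

(* Set^(nat^op); as for [nobj], a functor on nat^op is given by its values on
   the generating arrows n -> n+1. *)

Record psh := Psh {
  pobj :> nat -> Type;
  pres : forall n, pobj n.+1 -> pobj n }.

Record pmor (X Y : psh) := PMor {
  pmap :> forall n, X n -> Y n;
  pmor_natural : forall n (x : X n.+1),
    @pmap n (pres x) = pres (@pmap n.+1 x) }.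
Arguments pmap {X Y} _ n _.

Lemma pmor_ext (X Y : psh) (f g : pmor X Y) : (forall n, f n =1 g n) -> f = g.
Proof.
case: f g => [f fN] [g gN] /= fg.
have {fg} fg : f = g.
  by apply: functional_extensionality_dep => n; apply/funext; exact: fg.
by subst g; congr PMor; exact: Prop_irrelevance.
Qed.

Definition pcomp (X Y Z : psh) (g : pmor Y Z) (f : pmor X Y) : pmor X Z.
Proof.
exists (fun n => g n \o f n).
by move=> n x /=; rewrite !pmor_natural.
Defined.

Definition pone : psh := {| pobj := fun=> unit; pres := fun _ _ => tt |}.

Definition pprod (X Y : psh) : psh :=
  {| pobj := fun n => (X n * Y n)%type;
     pres := fun n xy => (pres xy.1, pres xy.2) |}.

Definition pprod_map (X Y X' Y' : psh) (f : pmor X X') (g : pmor Y Y') :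
  pmor (pprod X Y) (pprod X' Y').
Proof.
exists (fun n xy => (f n xy.1, g n xy.2)).
by move=> n xy /=; rewrite !pmor_natural.
Defined.

Definition later (X : psh) : psh :=
  {| pobj := fun n => if n is m.+1 then X m else unit;
     pres := fun n => if n is m.+1 then @pres X m else fun=> tt |}.

Definition later_map (X Y : psh) (f : pmor X Y) : pmor (later X) (later Y).
Proof.
exists (fun n => match n return later X n -> later Y n with
                 | 0 => id | m.+1 => f m end).
by case=> // n x /=; rewrite pmor_natural.
Defined.

Definition nu (X : psh) : pmor X (later X).
Proof.
exists (fun n => match n return X n -> later X n with
                 | 0 => fun=> tt | m.+1 => @pres X m end).
by case.
Defined.

(* The canonical isomorphisms  1 -> L 1  and  L X * L Y -> L (X * Y). *)
Definition later_one : pmor pone (later pone).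
Proof.
exists (fun n => match n return pone n -> later pone n with
                 | 0 => id | _.+1 => id end).
by case.
Defined.

Definition later_prod (X Y : psh) :
  pmor (pprod (later X) (later Y)) (later (pprod X Y)).
Proof.
exists (fun n => match n return
                   pprod (later X) (later Y) n -> later (pprod X Y) n with
                 | 0 => fun=> tt | _.+1 => id end).
by case.
Defined.

Section Enrichment.
Context {R : realType}.
Implicit Types X Y Z : nobj R.

Definition nhom_set X Y n : Type :=
  {h : coiso (X n) (Y n) | exists f : nmor X Y, f n = h}.

Lemma nhom_set_ext X Y n (h k : nhom_set X Y n) : sval h =1 sval k -> h = k.
Proof.
case: h k => [h hP] [k kP] /= /coiso_ext hk; subst k.
by congr exist; exact: Prop_irrelevance.
Qed.

Lemma dag_natural X Y (f : nmor X Y) n (y : Y n) :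
  dag (f n.+1) (dag (nres Y n) y) = dag (nres X n) (dag (f n) y).
Proof. by apply: hdot_injr => x; rewrite -!dagP nmor_natural. Qed.

Section Restriction.
Variables (X Y : nobj R) (n : nat) (h : nhom_set X Y n.+1).

Definition nhom_res_fun : X n -> Y n :=
  nres Y n \o sval h \o dag (nres X n).

Lemma nhom_res_funE (f : nmor X Y) : f n.+1 = sval h -> nhom_res_fun = f n.
Proof.
by move=> fh; apply/funext=> x; rewrite /nhom_res_fun/= -fh -nmor_natural coisoK.
Qed.

Definition nhom_res_coiso : coiso (X n) (Y n).
Proof.
exists nhom_res_fun (nres X n \o dag (sval h) \o dag (nres Y n)).
- by case: (svalP h) => f /nhom_res_funE ->; exact: coiso_linear.
- by case: (svalP h) => f /nhom_res_funE ->; exact: coiso_continuous.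
- case: (svalP h) => f fh x y; rewrite (nhom_res_funE fh) /= -fh.
  by rewrite dag_natural coisoK dagP.
- case: (svalP h) => f fh y; rewrite (nhom_res_funE fh) /= -fh.
  by rewrite dag_natural !coisoK.
Defined.

Definition nhom_res : nhom_set X Y n.
Proof.
exists nhom_res_coiso.
case: (svalP h) => f fh; exists f; apply: coiso_ext => x.
by rewrite -(nhom_res_funE fh).
Defined.

End Restriction.

Definition nhom X Y : psh := {| pobj := nhom_set X Y; pres := @nhom_res X Y |}.

Lemma nhom_resE X Y n (h : nhom X Y n.+1) (f : nmor X Y) :
  f n.+1 = sval h -> sval (pres h) = f n.
Proof. by move=> fh; apply: coiso_ext => x; rewrite /= (nhom_res_funE fh). Qed.

Definition nhom_id X : pmor pone (nhom X X).
Proof.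
exists (fun n _ => exist _ (coiso_id (X n)) (ex_intro _ (nid X) erefl)).
by move=> n _; apply: nhom_set_ext => x; rewrite (nhom_resE (f := nid X)).
Defined.

Definition nhom_comp X Y Z : pmor (pprod (nhom Y Z) (nhom X Y)) (nhom X Z).
Proof.
unshelve eexists.
- move=> n gf; exists (coiso_comp (sval gf.1) (sval gf.2)).
  case: gf => -[/= g [g' <-]] [/= f [f' <-]].
  by exists (ncomp g' f').
- move=> n -[[g [g' gg']] [f [f' ff']]]; apply: nhom_set_ext => x.
  rewrite (nhom_resE (f := ncomp g' f'))/= -?gg' -?ff'//=.
  by rewrite (nhom_res_funE (f := g'))// (nhom_res_funE (f := f')).
Defined.

End Enrichment.

Record efunctor (R : realType) := EFunctor {
  eobj :> nobj R -> nobj R;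
  ehom : forall X Y, pmor (nhom X Y) (nhom (eobj X) (eobj Y));
  ehom_id : forall X, pcomp (ehom X X) (nhom_id X) = nhom_id (eobj X);
  ehom_comp : forall X Y Z,
    pcomp (ehom X Z) (nhom_comp X Y Z) =
    pcomp (nhom_comp (eobj X) (eobj Y) (eobj Z))
          (pprod_map (ehom Y Z) (ehom X Y)) }.

Definition locally_contractive (R : realType) (T : efunctor R) : Prop :=
  exists G : forall X Y : nobj R,
      pmor (later (nhom X Y)) (nhom (T X) (T Y)),
    [/\ forall X Y, ehom T X Y = pcomp (G X Y) (nu (nhom X Y)),
        forall X Y Z,
          pcomp (G X Z) (pcomp (later_map (nhom_comp X Y Z))
                               (later_prod (nhom Y Z) (nhom X Y))) =
          pcomp (nhom_comp (T X) (T Y) (T Z)) (pprod_map (G Y Z) (G X Y))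
      & forall X,
          pcomp (G X X) (pcomp (later_map (nhom_id X)) later_one) =
          nhom_id (T X)].

(* Main.v *)
(** Any two objects of the form [T U], [T V] are canonically isomorphic at level
    0, and applying [T] raises the level of such an agreement by one.  Hence for
    [tower k = T^(k+1) 0] there are maps [down k : tower (k+1) -> tower k] and
    [up k : tower k -> tower (k+1)] that are mutually inverse at level [k].  The
    fixed point [X] is the diagonal [X n = tower n n], restricted along [down].

    An inverse of a component lies in the enriched hom only if it extends to a
    global morphism, so contractiveness applies to [X] only once there are
    global maps [proj k : X -> tower k] and [inj k : tower k -> X] that are
    mutually inverse at level [k].  They are the diagonals of one family
    [trans m k : tower m -> tower k].  The isomorphism [T X -> X] is, at level
    [n], the composite of [T (proj n)] and [down n]. *)
From HB Require Import structures.
From mathcomp Require Import all_boot all_order all_algebra.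
From mathcomp Require Import sesquilinear complex.
From mathcomp Require Import boolp classical_sets cardinality reals.
From mathcomp Require Import topology normedtype.
Require Import Defs.

Set Implicit Arguments.
Unset Strict Implicit.
Unset Printing Implicit Defensive.

Import Order.TTheory GRing.Theory Num.Theory.
Import numFieldNormedType.Exports.

Local Open Scope classical_set_scope.
Local Open Scope ring_scope.
Local Open Scope complex_scope.

(** * The zero Hilbert space, from which the iteration starts *)

Section ZeroObject.
Variable R : realType.
Let K : numFieldType := R[i].
Local Notation V := 'rV[K]_0.

Let V_eq (x y : V) : x = y. Proof. by apply/rowP; case. Qed.

Let V_complete (F : set_system V) : ProperFilter F -> cauchy F -> cvg F.
Proof.
move=> FF _; apply/cvg_ex; exists 0 => A /nbhs_singleton A0.
by apply: filterS filterT => x _; rewrite (V_eq x 0).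
Qed.

Let CV : completeNormedModType K :=
  HB.pack V (Uniform_isComplete.Build V V_complete).

Let dot0 (x y : CV) : R[i] := 0.

Let dot0_zmodl u' : zmod_morphism (dot0 ^~ u').
Proof. by move=> x y; rewrite subr0. Qed.

Let dot0_zmodr u : zmod_morphism (dot0 u).
Proof. by move=> x y; rewrite subr0. Qed.

Let dot0_scalel u' : scalable_for *%R (dot0 ^~ u').
Proof. by move=> a x; rewrite mulr0. Qed.

Let dot0_scaler u : scalable_for (Num.conj \; *%R) (dot0 u).
Proof. by move=> a x; rewrite /= mulr0. Qed.

Let dot0_herm (x y : CV) :
  dot0 x y = (-1) ^+ false * Num.conj (dot0 y x).
Proof. by rewrite /dot0 rmorph0 mulr0. Qed.

Let dot0_gt0 (u : CV) : u != 0 -> 0 < dot0 u u.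
Proof. by rewrite (V_eq u 0) eqxx. Qed.

Let dot0_dot : {dot CV for Num.conj} :=
  HB.pack dot0
    (isBilinear.Build R[i] CV CV R[i] *%R (Num.conj \; *%R) dot0
       dot0_zmodl dot0_zmodr dot0_scalel dot0_scaler)
    (isHermitianSesquilinear.Build R[i] CV false Num.conj dot0 dot0_herm)
    (isDotProduct.Build R[i] CV dot0 dot0_gt0).

Let dot0E (x : CV) : dot0_dot x x = `|x| ^+ 2.
Proof. by rewrite (V_eq x 0) normr0 expr0n. Qed.

Let dot0_dim : exists B : set CV,
  countable B /\ orthonormal_basis dot0_dot B.
Proof.
exists set0; split; first exact: countable0.
split=> // O [x Ox] _; exists x; split=> //.
(* The only combination of no vectors is the empty sum, and it equals every vector of a one-point
   space. *)
exists 0%N, (fun=> 0), (fun=> 0); split; first by case.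
exact: V_eq.
Qed.

Definition hilbert0 : hilbert R := Hilbert dot0E dot0_dim.

Definition nobj0 : nobj R := NObj (fun n : nat => coiso_id hilbert0).

End ZeroObject.

(** * Composition of coisometries and levelwise isomorphisms *)

Section CoisoCategory.
Variable R : realType.
Implicit Types H K M N : hilbert R.

Lemma coiso_compA H K M N (h : coiso M N) (g : coiso K M) (f : coiso H K) :
  coiso_comp h (coiso_comp g f) = coiso_comp (coiso_comp h g) f.
Proof. exact: coiso_ext. Qed.

Lemma coiso_comp1f H K (f : coiso H K) : coiso_comp (coiso_id K) f = f.
Proof. exact: coiso_ext. Qed.

Lemma coiso_compf1 H K (f : coiso H K) : coiso_comp f (coiso_id H) = f.
Proof. exact: coiso_ext. Qed.

Lemma nmor_square (X Y : nobj R) (f : nmor X Y) n :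
  coiso_comp (f n) (nres X n) = coiso_comp (nres Y n) (f n.+1).
Proof. by apply: coiso_ext => x; exact: nmor_natural. Qed.

Definition nmor_of_square (X Y : nobj R) (f : forall n, coiso (X n) (Y n))
    (fS : forall n,
       coiso_comp (f n) (nres X n) = coiso_comp (nres Y n) (f n.+1)) :
  nmor X Y := NMor (fun n x => congr1 (fun h : coiso _ _ => h x) (fS n)).

(** Naturality of the inverses is automatic: insert [f n.+1] after [g n.+1] next to [nres Y n],
    apply the square of [f], and cancel [g n] against [f n]. *)
Lemma is_niso_levelwise (X Y : nobj R) (f : nmor X Y)
    (g : forall n, coiso (Y n) (X n)) :
  (forall n, coiso_comp (g n) (f n) = coiso_id (X n)) ->
  (forall n, coiso_comp (f n) (g n) = coiso_id (Y n)) ->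
  is_niso f.
Proof.
move=> gf fg.
have gS n : coiso_comp (g n) (nres Y n) = coiso_comp (nres X n) (g n.+1).
  rewrite -[nres Y n]coiso_compf1 -(fg n.+1).
  rewrite (coiso_compA (nres Y n)) -nmor_square !coiso_compA gf.
  by rewrite coiso_comp1f.
exists (nmor_of_square gS); split; apply: nmor_ext => n x /=.
- by rewrite -[RHS]/(coiso_id (X n) x) -gf.
- by rewrite -[RHS]/(coiso_id (Y n) x) -fg.
Qed.

End CoisoCategory.

(** * The ordinary functor underlying [T] *)

Section UnderlyingFunctor.
Variables (R : realType) (T : efunctor R).
Implicit Types X Y Z : nobj R.

Definition nhom_of X Y (f : nmor X Y) n : nhom X Y n :=
  exist _ (f n) (ex_intro _ f erefl).

Lemma nhom_of_eq X Y (f g : nmor X Y) n :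
  f n = g n -> nhom_of f n = nhom_of g n.
Proof. by move=> fg; apply: nhom_set_ext => x /=; rewrite fg. Qed.

Lemma pres_nhom_of X Y (f : nmor X Y) n :
  pres (nhom_of f n.+1) = nhom_of f n.
Proof. by apply: nhom_set_ext => x; rewrite (nhom_resE (f := f)). Qed.

Definition emap X Y (f : nmor X Y) : nmor (T X) (T Y).
Proof.
exists (fun n => sval (ehom T X Y n (nhom_of f n))) => n x.
rewrite -pres_nhom_of pmor_natural.
(* The value at level [n.+1] is only known to extend to some morphism [g], which may vary with [n];
   the square of [g] at [n] suffices. *)
case: (svalP (ehom T X Y n.+1 (nhom_of f n.+1))) => g gE.
by rewrite (nhom_resE gE) -gE nmor_natural.
Defined.

Lemma emap_local X Y (f g : nmor X Y) n :
  f n = g n -> emap f n = emap g n.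
Proof. by move=> /nhom_of_eq /= ->. Qed.

Lemma emap_id X : emap (nid X) = nid (T X).
Proof.
apply: nmor_ext => n x /=.
have := congr1 (fun h : pmor pone (nhom (T X) (T X)) => sval (h n tt) x)
  (ehom_id T X).
apply: etrans; congr (sval (ehom T X X n _) x); exact: nhom_set_ext.
Qed.

Lemma emap_comp X Y Z (g : nmor Y Z) (f : nmor X Y) :
  emap (ncomp g f) = ncomp (emap g) (emap f).
Proof.
apply: nmor_ext => n x /=.
have := congr1 (fun h : pmor (pprod (nhom Y Z) (nhom X Y)) (nhom (T X) (T Z)) =>
  sval (h n (nhom_of g n, nhom_of f n)) x) (ehom_comp T X Y Z).
by move=> /= <-; congr (sval (ehom T X Z n _) x).
Qed.

End UnderlyingFunctor.

(** * Contractiveness and the tower of iterates *)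

Section FixedPoint.
Variables (R : realType) (T : efunctor R).
Variable G : forall X Y : nobj R, pmor (later (nhom X Y)) (nhom (T X) (T Y)).
Hypothesis ehomG : forall X Y, ehom T X Y = pcomp (G X Y) (nu (nhom X Y)).
Hypothesis G_comp : forall X Y Z,
  pcomp (G X Z) (pcomp (later_map (nhom_comp X Y Z))
                       (later_prod (nhom Y Z) (nhom X Y))) =
  pcomp (nhom_comp (T X) (T Y) (T Z)) (pprod_map (G Y Z) (G X Y)).
Hypothesis G_id : forall X,
  pcomp (G X X) (pcomp (later_map (nhom_id X)) later_one) = nhom_id (T X).
Implicit Types U V W X Y : nobj R.

Notation Tmap := (@emap R T _ _).

(** [ehom] factors through [nu], which at level [n.+1] restricts to level [n], so [Tmap f n.+1]
    depends on [f n] alone. *)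
Lemma emap_contractive X Y (f g : nmor X Y) n :
  f n = g n -> Tmap f n.+1 = Tmap g n.+1.
Proof.
have mapG (h : nmor X Y) : Tmap h n.+1 = sval (G X Y n.+1 (nhom_of h n)).
  by rewrite -pres_nhom_of [LHS]/= ehomG.
by move=> /nhom_of_eq fg; rewrite !mapG fg.
Qed.

(** [later] is a singleton at level 0, so [G] selects a map there without being given any morphism
    from [U] to [V]. *)
Definition canon U V : coiso (T U 0%N) (T V 0%N) := sval (G U V 0%N tt).

Lemma canon_id U : canon U U = coiso_id (T U 0%N).
Proof.
exact (congr1 (fun h : pmor pone (nhom (T U) (T U)) => sval (h 0%N tt))
  (G_id U)).
Qed.

Lemma canon_comp U V W : coiso_comp (canon V W) (canon U V) = canon U W.
Proof.
symmetry; exact (congr1 (fun h :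
    pmor (pprod (later (nhom V W)) (later (nhom U V))) (nhom (T U) (T W)) =>
  sval (h 0%N (tt, tt))) (G_comp U V W)).
Qed.

Lemma emap_canon U V (f : nmor U V) : Tmap f 0%N = canon U V.
Proof. by rewrite /= ehomG. Qed.

Definition base k := iter k T (nobj0 R).
(** One extra [T] is applied because [canon] relates only values of [T]. *)
Definition tower k := T (base k).

Section Tower.
Variables (down0 : nmor (tower 1) (tower 0)) (up0 : nmor (tower 0) (tower 1)).
Hypothesis down0_canon : down0 0%N = canon (base 1) (base 0).
Hypothesis up0_canon : up0 0%N = canon (base 0) (base 1).

Fixpoint down k : nmor (tower k.+1) (tower k) :=
  if k is k'.+1 then Tmap (down k') else down0.

Fixpoint up k : nmor (tower k) (tower k.+1) :=
  if k is k'.+1 then Tmap (up k') else up0.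

Fixpoint trans0 k : nmor (tower 0) (tower k) :=
  if k is k'.+1 then ncomp (up k') (trans0 k') else nid (tower 0).

(** Recursion on both indices makes [trans m.+1 k.+1] an image under [T], the form to which
    contractiveness applies. *)
Fixpoint trans m k : nmor (tower m) (tower k) :=
  match m, k with
  | 0, _ => trans0 k
  | m'.+1, 0 => ncomp (trans m' 0) (down m')
  | m'.+1, k'.+1 => Tmap (trans m' k')
  end.

Lemma down_canon k : down k 0%N = canon (base k.+1) (base k).
Proof. by case: k => [|k]; [exact: down0_canon | exact: emap_canon]. Qed.

Lemma up_canon k : up k 0%N = canon (base k) (base k.+1).
Proof. by case: k => [|k]; [exact: up0_canon | exact: emap_canon]. Qed.

Lemma down_up k : coiso_comp (down k k) (up k k) = coiso_id (tower k k).
Proof.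
elim: k => [|k IH]; first by rewrite down_canon up_canon canon_comp canon_id.
have := @emap_contractive _ _ (ncomp (down k) (up k)) (nid _) k IH.
by rewrite emap_comp emap_id.
Qed.

Lemma up_down k : coiso_comp (up k k) (down k k) = coiso_id (tower k.+1 k).
Proof.
elim: k => [|k IH]; first by rewrite down_canon up_canon canon_comp canon_id.
have := @emap_contractive _ _ (ncomp (up k) (down k)) (nid _) k IH.
by rewrite emap_comp emap_id.
Qed.

Lemma trans_canon m k : trans m k 0%N = canon (base m) (base k).
Proof.
elim: m k => [|m IHm] [|k].
- by rewrite canon_id.
- elim: k => [|k IHk]; rewrite [trans _ _]/=.
    by rewrite [LHS]coiso_compf1 up_canon.
  rewrite -(canon_comp _ (base k.+1)) -IHk -up_canon.
  exact: coiso_ext.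
- by rewrite -(canon_comp _ (base m)) -IHm -down_canon; exact: coiso_ext.
- exact: emap_canon.
Qed.

Lemma trans_id k : trans k k = nid (tower k).
Proof. by elim: k => //= k ->; rewrite emap_id. Qed.

(** For [k = 0] this is a clause of [trans]; otherwise [canon_comp] settles level 0 and
    [emap_contractive] lifts the equation by one level. *)
Lemma trans_downr n k : trans n.+1 k n = coiso_comp (trans n k n) (down n n).
Proof.
elim: n k => [|n IH] [|k] //.
  by rewrite down_canon !trans_canon canon_comp.
have := @emap_contractive _ _ (trans n.+1 k) (ncomp (trans n k) (down n)) n.
by rewrite emap_comp; apply; exact: IH.
Qed.

Lemma trans_downl n k : trans k n n = coiso_comp (down n n) (trans k n.+1 n).
Proof.
elim: n k => [|n IH] [|k].
- by rewrite down_canon !trans_canon canon_comp.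
- by rewrite down_canon !trans_canon canon_comp.
(* From [tower 0], [trans] ends with [up n.+1], which [down n.+1] cancels at this level. *)
- by rewrite [RHS]coiso_compA down_up coiso_comp1f.
have := @emap_contractive _ _ (trans k n) (ncomp (down n) (trans k n.+1)) n.
by rewrite emap_comp; apply; exact: IH.
Qed.

(** * The diagonal and its isomorphism with its image under [T] *)

Definition diagonal : nobj R :=
  @NObj R (fun n => tower n n)
    (fun n => coiso_comp (down n n) (nres (tower n.+1) n)).

Lemma proj_square k n :
  coiso_comp (trans n k n) (nres diagonal n) =
  coiso_comp (nres (tower k) n) (trans n.+1 k n.+1).
Proof.
rewrite [LHS]coiso_compA -trans_downr.
exact: (nmor_square (trans n.+1 k) n).
Qed.

Definition proj k : nmor diagonal (tower k) := nmor_of_square (proj_square k).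

Lemma inj_square k n :
  coiso_comp (trans k n n) (nres (tower k) n) =
  coiso_comp (nres diagonal n) (trans k n.+1 n.+1).
Proof.
rewrite -[RHS]coiso_compA -(nmor_square (trans k n.+1) n) trans_downl.
exact/esym/coiso_compA.
Qed.

Definition inj k : nmor (tower k) diagonal :=
  @nmor_of_square R (tower k) diagonal (fun n => trans k n n) (inj_square k).

Lemma emap_proj_inj n :
  coiso_comp (Tmap (proj n) n) (Tmap (inj n) n) = coiso_id (tower n.+1 n).
Proof.
have := @emap_local _ T _ _ (ncomp (proj n) (inj n)) (nid _) n.
rewrite emap_comp emap_id; apply.
by rewrite [LHS]/= trans_id; exact: coiso_compf1.
Qed.

Lemma emap_inj_proj n :
  coiso_comp (Tmap (inj n) n) (Tmap (proj n) n) = coiso_id (T diagonal n).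
Proof.
have := @emap_local _ T _ _ (ncomp (inj n) (proj n)) (nid _) n.
rewrite emap_comp emap_id; apply.
by rewrite [LHS]/= trans_id; exact: coiso_compf1.
Qed.

(** By [trans_downl], [proj n] and [down n] after [proj n.+1] agree at level [n]; [T] lifts this to
    the level that [fix_square] needs. *)
Lemma emap_proj_down n :
  Tmap (proj n) n.+1 = coiso_comp (down n.+1 n.+1) (Tmap (proj n.+1) n.+1).
Proof.
have := @emap_contractive _ _ (proj n) (ncomp (down n) (proj n.+1)) n.
by rewrite emap_comp; apply; exact: trans_downl.
Qed.

Definition fix_map n : coiso (T diagonal n) (diagonal n) :=
  coiso_comp (down n n) (Tmap (proj n) n).

Lemma fix_square n :
  coiso_comp (fix_map n) (nres (T diagonal) n) =
  coiso_comp (nres diagonal n) (fix_map n.+1).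
Proof.
rewrite /fix_map -emap_proj_down -[LHS]coiso_compA nmor_square.
exact: coiso_compA.
Qed.

Definition fix_mor : nmor (T diagonal) diagonal := nmor_of_square fix_square.

Lemma diagonal_fixed :
  exists (X : nobj R) (alpha : nmor (T X) X), is_niso alpha.
Proof.
exists diagonal, fix_mor.
(* The candidate inverse undoes the two factors of [fix_map n] in reverse order. *)
apply: (@is_niso_levelwise _ (T diagonal) diagonal fix_mor
  (fun n => coiso_comp (Tmap (inj n) n) (up n n))) => n.
- rewrite [X in coiso_comp _ X]/= /fix_map [LHS]coiso_compA.
  by rewrite -(coiso_compA (Tmap (inj n) n)) up_down coiso_compf1 emap_inj_proj.
- rewrite [X in coiso_comp X]/= /fix_map [LHS]coiso_compA.
  by rewrite -(coiso_compA (down n n)) emap_proj_inj coiso_compf1 down_up.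
Qed.

End Tower.

Lemma fixed_point :
  exists (X : nobj R) (alpha : nmor (T X) X), is_niso alpha.
Proof.
(* Membership in the enriched hom extends the canonical maps to global morphisms; these are known to
   be mutually inverse only at level 0. *)
have [d dE] := svalP (G (base 1) (base 0) 0%N tt).
have [u uE] := svalP (G (base 0) (base 1) 0%N tt).
exact: (diagonal_fixed dE uE).
Qed.

End FixedPoint.

Theorem theorem5p28 (R : realType) (T : efunctor R) :
  locally_contractive T ->
  exists (X : nobj R) (alpha : nmor (T X) X), is_niso alpha.
Proof. by case=> G [ehomG G_comp G_id]; exact: (fixed_point ehomG). Qed.
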